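(* Let $d\ge1$ and let $\mathcal D_f$ be an $f$-divergence on the set $\mathcal P$ of Borel probability measures on $\mathbb R^d$. Fix $m\in\mathbb R^d$ and $M\in\mathcal S_{++}^d$, and let $\mathbb P\in\mathcal P$ be elliptically symmetric about $m$ with scale matrix $M$. Let $\mathbb Q_0\in\mathcal P$ be an $\mathrm O(d)$-invariant base distribution, and let $\mathcal Q=\{\mathbb Q_{\nu,S}\mid\nu\in\mathbb R^d,\ S\in\mathcal S_{++}^d\}$ be the location--scale family it generates. If $(\nu,S)\mapsto\mathcal D_f(\mathbb P\|\mathbb Q_{\nu,S})$ has a unique minimiser $(\nu^\star,S^\star)$ over $\mathbb R^d\times\mathcal S_{++}^d$, then: (i) if $\mathbb P,\mathbb Q_0\in\mathcal P_1$, then $\mu(\mathbb Q_{\nu^\star,S^\star})=\mu(\mathbb P)=m$; (ii) if $\mathbb P,\mathbb Q_0\in\mathcal P_2$ and neither is a Dirac measure, then $\Sigma(\mathbb Q_{\nu^\star,S^\star}),\ \Sigma(\mathbb P)\in\{\lambda M\mid\lambda>0\}$; (iii) if in addition to the hypotheses of (ii) $\mathbb P,\mathbb Q_0\in\mathcal P_2^\circ$, then $$\rho(\mathbb Q_{\nu^\star,S^\star})=\rho(\mathbb P)=\operatorname{diag}(M)^{-1/2}\,M\,\operatorname{diag}(M)^{-1/2}.$$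
   Context: $\mathcal P_n\subseteq\mathcal P$ is the set of probability measures with finite $n$-th moment; $\mathcal P_2^\circ\subseteq\mathcal P_2$ is the subset of those whose coordinate marginals all have positive variance. $\mathcal S_{++}^d$ is the set of real (symmetric) positive-definite $d\times d$ matrices and $\mathrm O(d)$ the group of real orthogonal $d\times d$ matrices. For $\pi\in\mathcal P_1$, $\mu(\pi)$ is the mean; for $\pi\in\mathcal P_2$, $\Sigma(\pi)$ is the covariance matrix; for $\pi\in\mathcal P_2^\circ$, $\rho(\pi):=D(\pi)^{-1/2}\Sigma(\pi)D(\pi)^{-1/2}$ with $D(\pi):=\operatorname{diag}(\Sigma(\pi))$ is the correlation matrix. For a square matrix $M$, $\operatorname{diag}(M)$ is the diagonal matrix with the same diagonal as $M$. **Pushforward and invariance.** $T_\#\pi(A):=\pi(T^{-1}(A))$. A measure $\pi\in\mathcal P$ is $\mathrm O(d)$-invariant if $R_\#\pi=\pi$ for all $R\in\mathrm O(d)$ (acting by $x\mapsto Rx$). **Elliptical symmetry.** With $T_{\gamma,C}(x):=\gamma+C^{1/2}x$, a measure $\pi\in\mathcal P$ is elliptically symmetric about $\gamma\in\mathbb R^d$ with scale matrix $C\in\mathcal S_{++}^d$ if there is an $\mathrm O(d)$-invariant $\pi_0\in\mathcal P$ with $\pi=(T_{\gamma,C})_\#\pi_0$. **Location--scale family.** The family generated by $\mathbb Q_0\in\mathcal P$ consists of $\mathbb Q_{\nu,S}:=(T_{\nu,S})_\#\mathbb Q_0$, $\nu\in\mathbb R^d$, $S\in\mathcal S_{++}^d$.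 **$f$-divergence.** Let $f\colon\mathbb R_{>0}\to\mathbb R$ be convex with $f(1)=0$, extended by $f(0):=\lim_{t\downarrow0}f(t)$ and $f'(\infty):=\lim_{t\downarrow0}t f(1/t)$ (both possibly $+\infty$). For probability measures $\mathbb P,\mathbb Q$ and any $\sigma$-finite measure $\lambda$ dominating both, with densities $p=d\mathbb P/d\lambda$, $q=d\mathbb Q/d\lambda$, $$\mathcal D_f(\mathbb P\|\mathbb Q):=\int_{\{q>0\}}q\,f(p/q)\,d\lambda+f'(\infty)\,\mathbb P(\{q=0\})\in[0,\infty],\qquad 0\cdot\infty:=0.$$ *)

(* Defs.v *)
From HB Require Import structures.
From mathcomp Require Import all_boot all_order all_algebra.
From mathcomp Require Import all_classical all_reals all_analysis.
From mathcomp Require Import measurable_realfun ring.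

Set Implicit Arguments.
Unset Strict Implicit.
Unset Printing Implicit Defensive.

Import Order.TTheory GRing.Theory Num.Theory.
Import numFieldTopology.Exports numFieldNormedType.Exports.

Local Open Scope classical_set_scope.
Local Open Scope ring_scope.

(** * Matrices *)

Section matrices.
Context {R : realType} {d : nat}.
Implicit Types C : 'M[R]_d.

Definition posdefmx C : Prop :=
  C^T = C /\ forall x : 'cV[R]_d, x != 0 -> 0 < (x^T *m C *m x) 0 0.

Definition orthogonalmx (O : 'M[R]_d) : Prop := O^T *m O = 1%:M.

(* A positive-definite matrix has exactly one positive-definite square root,
   selected here; a matrix that is not positive definite is sent to 0. *)
Definition sqrtmx C : 'M[R]_d := xget 0 [set B | posdefmx B /\ B *m B = C].

Definition diagmx C : 'M[R]_d := diag_mx (\row_i C i i).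

(* [diag(C)^{-1/2} C diag(C)^{-1/2}] *)
Definition normalise_diag C : 'M[R]_d :=
  invmx (sqrtmx (diagmx C)) *m C *m invmx (sqrtmx (diagmx C)).

End matrices.

(** * Borel probability measures on [R^d] *)

(* Column vectors with the sigma-algebra generated by the open sets. *)
Notation borelRd R d := (g_sigma_algebraType (@open 'cV[R]_d)).

Section borel_probabilities.
Context {R : realType} {d : nat}.
Local Notation T := (borelRd R d).
Implicit Types P : probability T R.

(* The library norm on matrices is the sup norm. *)
Definition enorm (x : 'cV[R]_d) : R := Num.sqrt (\sum_(i < d) x i 0 ^+ 2).

Definition finite_moment (n : nat) P : Prop :=
  (\int[P]_x (enorm x ^+ n)%:E < +oo)%E.

Definition coord (i : 'I_d) (x : 'cV[R]_d) : R := x i 0.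

Definition mean P : 'cV[R]_d := \col_i fine ('E_P[coord i])%E.

Definition covmx P : 'M[R]_d :=
  \matrix_(i, j) fine (covariance P (coord i) (coord j)).

Definition corrmx P : 'M[R]_d := normalise_diag (covmx P).

Definition finite_moment2_nondegenerate P : Prop :=
  finite_moment 2 P /\ forall i : 'I_d, (0 < 'V_P[coord i])%E.

(* Set functions carry junk values on nonmeasurable sets, so equality of
   measures is tested on measurable sets only. *)
Definition eq_measure (m1 m2 : set T -> \bar R) : Prop :=
  forall A : set T, measurable A -> m1 A = m2 A.

Definition is_dirac P : Prop := exists a : T, eq_measure P (dirac a).

Definition Od_invariant P : Prop :=
  forall O : 'M[R]_d, orthogonalmx O ->
    eq_measure (pushforward P (fun x : T => O *m x : T)) P.

Definition loc_scale_map (g : 'cV[R]_d) (C : 'M[R]_d) (x : T) : T :=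
  g + sqrtmx C *m x.

Definition elliptically_symmetric P (g : 'cV[R]_d) (C : 'M[R]_d) : Prop :=
  exists2 P0 : probability T R, Od_invariant P0 &
    eq_measure P (pushforward P0 (loc_scale_map g C)).

Lemma continuous_affine (g : 'cV[R]_d) (B : 'M[R]_d) :
  continuous (fun x : 'cV[R]_d => g + B *m x).
Proof.
move=> x; have FF : Filter (nbhs x) by exact: nbhs_filter.
apply/cvg_ballP => e e0.
have cvg_coord i : (fun y : 'cV[R]_d => (g + B *m y) i 0) @ x -->
    (g + B *m x) i 0.
  have E (y : 'cV[R]_d) : (g + B *m y) i 0 = g i 0 + \sum_j B i j * y j 0.
    by rewrite !mxE.
  rewrite E (funext E); apply: cvgD; first exact: cvg_cst.
  elim: (index_enum _) => [|j r IH].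
    rewrite big_nil (_ : (fun y => _) = cst 0); first exact: cvg_cst.
    by apply/funext => y; rewrite big_nil.
  rewrite big_cons.
  rewrite (_ : (fun y : 'cV[R]_d => _) =
    (fun y => B i j * y j 0 + \sum_(k <- r) B i k * y k 0)); last first.
    by apply/funext => y; rewrite big_cons.
  apply: cvgD IH; apply: cvgM; first exact: cvg_cst.
  exact: coord_continuous.
have H i : \forall y \near x, ball ((g + B *m x) i 0) e ((g + B *m y) i 0).
  by have /cvg_ballP := cvg_coord i; apply.
have {}H := @filter_forall _ _ _ _ FF H.
apply: filterS H => y Hy; split => // i j.
by rewrite (ord1 j); exact: Hy.
Qed.

Lemma measurable_loc_scale_map g C : measurable_fun setT (loc_scale_map g C).
Proof.
apply: (@measurability _ _ T T setT (loc_scale_map g C) (@open 'cV[R]_d)).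
  by [].
move=> _ [B oB <-]; rewrite setTI; apply: sub_sigma_algebra.
by apply: open_comp oB => x _; exact: continuous_affine.
Qed.

HB.instance Definition _ g C := @isMeasurableFun.Build _ _ T T
  (loc_scale_map g C) (measurable_loc_scale_map g C).

(* [distribution] is the pushforward bundled as a probability. *)
Definition loc_scale P (nu : 'cV[R]_d) (S : 'M[R]_d) : probability T R :=
  distribution P (loc_scale_map nu S).

End borel_probabilities.

(** * f-divergences *)

Section measure_add_finite.
Context d (T : measurableType d) (R : realType).
Variables m1 m2 : {finite_measure set T -> \bar R}.

Let finite_measure_add : fin_num_fun (measure_add m1 m2).
Proof.
by move=> A mA; rewrite measure_addE fin_numD !fin_num_measure.
Qed.

HB.instance Definition _ := Measure.on (measure_add m1 m2).
HB.instance Definition _ := @Measure_isFinite.Build _ _ _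
  (measure_add m1 m2) finite_measure_add.

End measure_add_finite.

Section fdiv.
Context d (T : measurableType d) (R : realType).
Variable f : R -> R.
Implicit Types (P Q : probability T R) (p q : T -> R).
Implicit Types lam : {sigma_finite_measure set T -> \bar R}.
Local Open Scope ereal_scope.

(* [f(0)] *)
Definition fdiv_at0 : \bar R := lim ((f t)%:E @[t --> 0%R^'+]).

(* [f'(oo)] *)
Definition fdiv_slope : \bar R := lim ((t * f t^-1)%:E @[t --> 0%R^'+]).

Definition fdiv_ext (t : R) : \bar R :=
  if (0 < t)%R then (f t)%:E else fdiv_at0.

Definition is_density lam P p : Prop :=
  [/\ measurable_fun setT p, (forall x, (0 <= p x)%R) &
      forall A, measurable A -> P A = \int[lam]_(x in A) (p x)%:E].

Definition fdiv_wrt lam p q P : \bar R :=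
  \int[lam]_(x in [set x | (0 < q x)%R]) ((q x)%:E * fdiv_ext (p x / q x))
  + fdiv_slope * P [set x | q x = 0%R].

(* The dominating measure [P + Q] is used here; lemma [fdivE] below shows that
   any other dominating measure and densities give the same value. *)
Definition fdiv P Q : \bar R :=
  let lam := measure_add P Q in
  let dens P' x := fine (Radon_Nikodym (charge_of_finite_measure P') lam x) in
  fdiv_wrt lam (dens P) (dens Q) P.

End fdiv.

Section fdivE.
Context d (T : measurableType d) (R : realType).
Variable f : R -> R.
Hypothesis f_convex : @convex_function R R^o `]0, +oo[%classic f.
Local Open Scope ereal_scope.

Let measurable_fdiv_ext : measurable_fun [set: R] (fdiv_ext f).
Proof.
apply: measurable_fun_if => //; first exact: measurable_fun_ltr.
have -> : setT `&` (fun t : R => (0 < t)%R) @^-1` [set true] = `]0%R, +oo[%classic.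
  by apply/seteqP; split=> t /=; rewrite in_itv/= andbT; tauto.
apply/measurable_EFinP.
apply: (measurability (@RGenInftyO.G R)) => [|/= _ [_] [r] -> <-].
  exact: RGenInftyO.measurableE.
apply: is_interval_measurable => s t/=.
rewrite !in_itv/= !andbT => -[s0 fs] [t0 ft] u /andP[su ut].
rewrite !in_itv/= andbT; split; first exact: lt_le_trans su.
have [st|st] := eqVneq s t.
  by rewrite (_ : u = s)//; apply/le_anti; rewrite su st ut.
have ts0 : (0 < t - s)%R.
  by rewrite subr_gt0 lt_neqAle st (le_trans su).
have [k [k0 k1 uE]] : exists k : R, [/\ 0 <= k, k <= 1 & u = k * s + (1 - k) * t]%R.
  exists ((t - u) / (t - s))%R; split.
  - by rewrite divr_ge0 ?subr_ge0// (le_trans su).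
  - by rewrite ler_pdivrMr// mul1r lerD2l lerN2.
  - have ts : (t - s != 0)%R by rewrite gt_eqF.
    by field.
have := f_convex (Itv01 k0 k1) (x := s) (y := t).
rewrite !inE/= !in_itv/= !andbT => /(_ s0 t0).
move=> H; apply: (@le_lt_trans _ _ (k * f s + (1 - k) * f t)%R).
  by rewrite [in leLHS]uE; exact: H.
have [->|kn0] := eqVneq k 0%R; first by rewrite mul0r add0r subr0 mul1r.
have kgt0 : (0 < k)%R by rewrite lt_neqAle eq_sym kn0.
rewrite [ltRHS](_ : r = k * r + (1 - k) * r)%R; last by ring.
by rewrite ltr_leD// ?ltr_pM2l// ler_wpM2l ?subr_ge0// ltW.
Qed.

Variable lam : {sigma_finite_measure set T -> \bar R}.

Let dominates_density (nu : {finite_measure set T -> \bar R}) (h : T -> R) :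
  measurable_fun setT h ->
  (forall A, measurable A -> nu A = \int[lam]_(x in A) (h x)%:E) -> nu `<< lam.
Proof.
move=> mh nuE; apply/null_content_dominatesP => A mA lamA0.
rewrite nuE//; apply: null_set_integral => //.
exact/measurable_EFinP/measurable_funTS.
Qed.

Let RN_density (nu : {finite_measure set T -> \bar R}) (h : T -> R) :
  measurable_fun setT h ->
  (forall A, measurable A -> nu A = \int[lam]_(x in A) (h x)%:E) ->
  ae_eq lam setT (Radon_Nikodym (charge_of_finite_measure nu) lam) (EFin \o h).
Proof.
move=> mh nuE; have nulam := dominates_density mh nuE.
apply: integral_ae_eq => //.
- exact: Radon_Nikodym_integrable.
- exact/measurable_EFinP.
- by move=> A _ mA; rewrite -Radon_Nikodym_integral//; exact: nuE.
Qed.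

Let integral_density (nu : {finite_measure set T -> \bar R}) (h : T -> R)
    (g : T -> \bar R) :
  measurable_fun setT h -> (forall x, (0 <= h x)%R) ->
  (forall A, measurable A -> nu A = \int[lam]_(x in A) (h x)%:E) ->
  measurable_fun setT g -> (forall x, 0 <= g x) ->
  \int[nu]_x g x = \int[lam]_x (g x * (h x)%:E).
Proof.
move=> mh h0 nuE mg g0; have nulam := dominates_density mh nuE.
rewrite -(Radon_Nikodym_SigmaFinite.change_of_variables nulam)//.
have mF : measurable_fun setT (Radon_Nikodym_SigmaFinite.f nu lam).
  exact: measurable_int (Radon_Nikodym_SigmaFinite.f_integrable nulam).
apply: ge0_ae_eq_integral => //.
- exact: emeasurable_funM.
- by apply: emeasurable_funM => //; exact/measurable_EFinP.
- by move=> x _; rewrite mule_ge0// Radon_Nikodym_SigmaFinite.f_ge0.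
- by move=> x _; rewrite mule_ge0// lee_fin.
apply: ae_eqe_mul2l; apply: ae_eq_trans (RN_density mh nuE).
exact: ae_eq_Radon_Nikodym_SigmaFinite.
Qed.

(* The integrand of [fdiv_wrt], extended by 0. *)
Let G (a b : R) : \bar R :=
  if (0 < b)%R then b%:E * fdiv_ext f (a / b) else 0.

Let G_homogeneous a b c : (0 <= c)%R -> G (a * c)%R (b * c)%R = G a b * c%:E.
Proof.
rewrite le_eqVlt => /predU1P[<-|c0]; first by rewrite /G !mulr0 ltxx mule0.
rewrite /G pmulr_lgt0//; case: ifPn => b0; last by rewrite mul0e.
rewrite EFinM muleAC; congr (_ * fdiv_ext f _ * _).
by rewrite -mulf_div divff ?mulr1// gt_eqF.
Qed.

Let measurable_G (p q : T -> R) : measurable_fun setT p ->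
  measurable_fun setT q -> measurable_fun setT (fun x => G (p x) (q x)).
Proof.
move=> mp mq; apply: measurable_fun_if => //; first exact: measurable_fun_ltr.
set D := (X in measurable_fun X).
have mD : measurable D.
  have mb : measurable_fun setT (fun x => 0 < q x)%R.
    exact: measurable_fun_ltr.
  exact: (mb measurableT [set true]).
apply: emeasurable_funM; first exact/measurable_EFinP/measurable_funTS.
apply: (measurableT_comp measurable_fdiv_ext).
apply: measurable_funM; first exact: measurable_funTS.
apply: (eq_measurable_fun (fun x => q x `^ (-1))%R).
  move=> x; rewrite inE /D/= => -[_ q0].
  by rewrite powR_inv1// ltW.
by apply: measurable_funTS; exact: (measurableT_comp (measurable_powR _) mq).
Qed.

Let fdiv_wrtE (l : {sigma_finite_measure set T -> \bar R})
    (P : probability T R) (p q : T -> R) :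
  fdiv_wrt f l p q P = \int[l]_x G (p x) (q x)
                     + fdiv_slope f * P [set x | q x = 0%R].
Proof.
rewrite /fdiv_wrt integral_mkcond; congr (_ + _); apply: eq_integral => x _.
rewrite patchE /G; case: ifPn; first by rewrite inE /= => ->.
by rewrite notin_setE/= => /negP/negbTE ->.
Qed.

Lemma fdivE (P Q : probability T R) (p q : T -> R) :
  is_density lam P p -> is_density lam Q q ->
  fdiv f P Q = fdiv_wrt f lam p q P.
Proof.
move=> [mp p0 PE] [mq q0 QE]; rewrite /fdiv.
set mu := measure_add P Q.
have addE A : mu A = P A + Q A by exact: measure_addE.
have domP : P `<< mu.
  apply/null_content_dominatesP => A mA muA0.
  have /eqP : P A + Q A = 0 by rewrite -addE; exact: muA0.
  by rewrite padde_eq0// => /andP[/eqP].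
have domQ : Q `<< mu.
  apply/null_content_dominatesP => A mA muA0.
  have /eqP : P A + Q A = 0 by rewrite -addE; exact: muA0.
  by rewrite padde_eq0// => /andP[_ /eqP].
set p' := (X in fdiv_wrt _ _ X); set q' := (X in fdiv_wrt _ _ _ X).
have finRN (P' : probability T R) : P' `<< mu ->
    EFin \o (fun x => fine (Radon_Nikodym (charge_of_finite_measure P') mu x))
    = Radon_Nikodym (charge_of_finite_measure P') mu.
  by move=> dom; apply/funext => x /=; rewrite fineK// Radon_Nikodym_fin_num.
have mp' : measurable_fun setT p'.
  by apply/measurable_EFinP; rewrite finRN//; exact: measurable_int (Radon_Nikodym_integrable _).
have mq' : measurable_fun setT q'.
  by apply/measurable_EFinP; rewrite finRN//; exact: measurable_int (Radon_Nikodym_integrable _).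
pose h x := (p x + q x)%R.
have mh : measurable_fun setT h by exact: measurable_funD.
have h0 x : (0 <= h x)%R by exact: addr_ge0.
have muE A : measurable A -> mu A = \int[lam]_(x in A) (h x)%:E.
  move=> mA; rewrite addE PE// QE//.
  rewrite -ge0_integralD//; [by move=> x _; rewrite lee_fin|
    exact/measurable_EFinP/measurable_funTS|by move=> x _; rewrite lee_fin|
    exact/measurable_EFinP/measurable_funTS].
have mulam := dominates_density mh muE.
have chain (P' : probability T R) (r : T -> R) : P' `<< mu -> measurable_fun setT r ->
    (forall A, measurable A -> P' A = \int[lam]_(x in A) (r x)%:E) ->
    {ae lam, forall x, r x =
      (fine (Radon_Nikodym (charge_of_finite_measure P') mu x) * h x)%R}.
  move=> dom mr rE.
  have H1 := RN_density mr rE; have H2 := RN_density mh muE.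
  have H3 := @Radon_Nikodym_chain_rule _ _ _ (charge_of_finite_measure P') lam mu dom mulam.
  move: H1 H2 H3; apply: filterS3 => x /(_ I) H1 /(_ I) H2 /(_ I) H3.
  apply: EFin_inj; rewrite -[LHS]H1 H3/= H2/= EFinM fineK//.
  exact: Radon_Nikodym_fin_num.
have pE := chain P p domP mp PE; have qE := chain Q q domQ mq QE.
rewrite !fdiv_wrtE; congr (_ + _ * _).
  have mG' := measurable_G mp' mq'; have mG := measurable_G mp mq.
  rewrite integralE [RHS]integralE; congr (_ - _).
    rewrite (integral_density mh h0 muE)//; last exact: measurable_funepos.
    apply: ge0_ae_eq_integral => //.
    - apply: emeasurable_funM; last exact/measurable_EFinP.
      exact: measurable_funepos.
    - exact: measurable_funepos.
    - by move=> x _; rewrite mule_ge0// lee_fin.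
    - move: pE qE; apply: filterS2 => x px qx _.
      by rewrite !funeposE px qx G_homogeneous// maxe_pMl ?lee_fin// mul0e.
  rewrite (integral_density mh h0 muE)//; last exact: measurable_funeneg.
  apply: ge0_ae_eq_integral => //.
  - apply: emeasurable_funM; last exact/measurable_EFinP.
    exact: measurable_funeneg.
  - exact: measurable_funeneg.
  - by move=> x _; rewrite mule_ge0// lee_fin.
  - move: pE qE; apply: filterS2 => x px qx _.
    by rewrite !funenegE px qx G_homogeneous// -mulNe maxe_pMl ?lee_fin// mul0e.
have mz (r : T -> R) : measurable_fun setT r -> measurable [set x | r x = 0%R].
  by move=> mr; rewrite -[X in measurable X]setTI; apply: (mr _ [set 0%R]).
rewrite !PE; [|exact: mz..].
rewrite integral_mkcond [RHS]integral_mkcond.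
apply: ge0_ae_eq_integral => //.
- apply/(measurable_restrictT _ (mz _ mq'))/measurable_EFinP.
  exact: measurable_funTS.
- apply/(measurable_restrictT _ (mz _ mq))/measurable_EFinP.
  exact: measurable_funTS.
- by move=> x _; rewrite patchE; case: ifP => // _; rewrite lee_fin.
- by move=> x _; rewrite patchE; case: ifP => // _; rewrite lee_fin.
move: qE; apply: filterS => x qx _; rewrite !patchE.
have [->|pN0] := eqVneq (p x) 0%R; first by rewrite !if_same.
have hx0 : (h x != 0)%R.
  rewrite gt_eqF// (lt_le_trans _ (_ : p x <= _)%R)//; last by rewrite lerDl.
  by rewrite lt_neqAle eq_sym pN0 p0.
congr (if _ then _ else _); apply/idP/idP; rewrite !inE/= qx => H.
  by rewrite /q' in H; rewrite H mul0r.
by move/eqP : H; rewrite mulf_eq0 (negbTE hx0) orbF => /eqP.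
Qed.

End fdivE.

(** * Unique minimisers *)

Definition is_minimiser (R : realType) (X : Type) (D : set X) (F : X -> \bar R)
  (x : X) : Prop := D x /\ forall y, D y -> (F x <= F y)%E.

Definition is_unique_minimiser (R : realType) (X : Type) (D : set X)
    (F : X -> \bar R) (x : X) : Prop :=
  is_minimiser D F x /\ forall y, is_minimiser D F y -> y = x.

(* Main.v *)
(* For orthogonal [O] let [A = M^{1/2} O M^{-1/2}]. The affine map
   [x |-> m + A (x - m)] preserves [P], and since [Q0] is rotation invariant it
   maps [Q_{nu,S}] to [Q_{nu',S'}] with [nu' = m + A (nu - m)], [S' = A S A^T]
   (the factor [S'^{-1/2} A S^{1/2}] is orthogonal). An f-divergence is invariant
   under bimeasurable bijections, so a unique minimiser is fixed by all these
   maps. [O = -1] gives [nu = m]; letting [O] range over sign changes and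
   transpositions shows that [M^{-1/2} S M^{-1/2}] is scalar. The same symmetries
   determine the mean and, up to a scalar, the covariance of [P] and of [Q0]; the
   scalar vanishes only for a Dirac measure. *)
Require Import Defs.
From mathcomp Require Import all_boot all_order all_algebra.
From mathcomp Require Import all_classical all_reals all_analysis.
From mathcomp Require Import perm complex spectral sesquilinear.
From mathcomp Require Import measurable_realfun ring.

Set Implicit Arguments.
Unset Strict Implicit.

Import Order.TTheory GRing.Theory Num.Theory.
Import numFieldTopology.Exports numFieldNormedType.Exports.
Local Open Scope classical_set_scope.
Local Open Scope ring_scope.

(** * Square roots of positive definite matrices *)

(** Turns a trace into a sum of forms on columns, to which the positivity of [A] applies one column
    at a time. *)
Lemma mulmx3_trace_col (C : comPzRingType) n (E A F : 'M[C]_n) :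
  \tr (E^T *m A *m F) = \sum_j ((col j E)^T *m A *m col j F) 0 0.
Proof.
apply: eq_bigr => j _.
by rewrite tr_col -row_mul !mxE; apply: eq_bigr => k _; rewrite !mxE.
Qed.

(* If [B ^ 2 = B' ^ 2] and [E = B - B'] then [B E + E B' = 0], so that the
   nonnegative numbers [tr (E* B E)] and [tr (E* B' E)] add up to 0. The
   involution [s] is conjugation for complex and the identity for real
   matrices. *)
Lemma posdef_sqrt_unique (C : numFieldType) (s : {rmorphism C -> C}) n
    (B B' : 'M[C]_n) :
  map_mx s B^T = B -> map_mx s B'^T = B' ->
  (forall x : 'cV_n, x != 0 -> 0 < (map_mx s x^T *m B *m x) 0 0) ->
  (forall x : 'cV_n, x != 0 -> 0 < (map_mx s x^T *m B' *m x) 0 0) ->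
  B *m B = B' *m B' -> B = B'.
Proof.
move=> Bs B's B0 B'0 BB; pose E := B - B'.
have Es : map_mx s E^T = E by rewrite /E linearB/= map_mxB Bs B's.
have tr_form A : \tr (E *m A *m E) =
    \sum_j (map_mx s (col j E)^T *m A *m col j E) 0 0.
  rewrite -{1}Es -map_trmx mulmx3_trace_col; apply: eq_bigr => j _.
  by rewrite -map_col map_trmx.
have ge0 A : (forall x : 'cV_n, x != 0 -> 0 < (map_mx s x^T *m A *m x) 0 0) ->
    forall j, 0 <= (map_mx s (col j E)^T *m A *m col j E) 0 0.
  move=> A0 j; have [->|/A0/ltW//] := eqVneq (col j E) 0.
  by rewrite mulmx0 mxE.
have : \tr (E *m B *m E) + \tr (E *m B' *m E) = 0.
  have EB0 : B *m E + E *m B' = 0.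
    by rewrite mulmxBr mulmxBl BB addrA subrK subrr.
  (* By cyclicity the sum of the traces is the trace of [E (B E + E B')]. *)
  by rewrite [X in _ + X]mxtrace_mulC -mulmxA -mxtraceD -mulmxDr EB0 mulmx0 mxtrace0.
rewrite !tr_form => /eqP; rewrite paddr_eq0 ?sumr_ge0//; last 2 first.
  by move=> j _; exact: ge0.
  by move=> j _; exact: ge0.
(* The form of [B] vanishes at every column of [E], so each column is 0. *)
move=> /andP[/eqP + _] => /psumr_eq0P trB.
apply/subr0_eq/matrixP => i j; rewrite [RHS]mxE -/E.
have [/matrixP/(_ i 0)|/B0] := eqVneq (col j E) 0; first by rewrite !mxE.
by rewrite trB ?ltxx// => k _; exact: ge0.
Qed.

(** Complex counterpart of [posdefmx], the setting of the spectral theorem. In the order on [C],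
    [0 < z] also says that [z] is real. *)
Definition hermposdefmx {C : numClosedFieldType} {n} (X : 'M[C]_n) : Prop :=
  map_mx Num.conj X^T = X /\
  forall x : 'cV_n, x != 0 -> 0 < (map_mx Num.conj x^T *m X *m x) 0 0.

(** * Square roots of Hermitian positive definite matrices *)

Section hermitian_sqrt.
Context {C : numClosedFieldType} {n : nat}.
Implicit Types A X Y : 'M[C]_n.

Lemma hermposdefmx_sqrt_unique X Y :
  hermposdefmx X -> hermposdefmx Y -> X *m X = Y *m Y -> X = Y.
Proof. by move=> [XH X0] [YH Y0]; exact: (@posdef_sqrt_unique _ Num.conj). Qed.

Lemma map_mx_conjCK m p (x : 'M[C]_(m, p)) :
  map_mx Num.conj (map_mx Num.conj x) = x.
Proof. by apply/matrixP => i j; rewrite !mxE conjCK. Qed.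

(** The form of the conjugate of [X] at [x] is the conjugate of the form of [X] at the conjugate of
    [x], a positive and hence real number. *)
Lemma hermposdefmx_conj X : hermposdefmx X -> hermposdefmx (map_mx Num.conj X).
Proof.
move=> [XH X0]; split=> [|x x0].
  by have -> : (map_mx Num.conj X)^T = X by rewrite map_trmx; exact: XH.
have x'0 : map_mx Num.conj x != 0.
  apply: contra_neq x0 => /(congr1 (map_mx Num.conj)).
  by rewrite map_mx_conjCK map_mx0.
have r0 := X0 _ x'0; set r := (X in 0 < X) in r0.
suff -> : (map_mx Num.conj x^T *m map_mx Num.conj X *m x) 0 0 = r^*.
  by have -> := conj_Creal (gtr0_real r0).
have -> : r^* = (map_mx Num.conj (map_mx Num.conj
    (map_mx Num.conj x)^T *m X *m map_mx Num.conj x)) 0 0.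
  by rewrite [RHS]mxE.
by rewrite !map_mxM/= !map_mx_conjCK map_trmx.
Qed.

(** Diagonalise [A] by a unitary [U] and take square roots of the eigenvalues, which are
    positive. *)
Lemma hermposdefmx_sqrt_exists A : hermposdefmx A ->
  exists2 X, hermposdefmx X & X *m X = A.
Proof.
move=> [AH A0].
have /orthomx_spectralP : A \is normalmx.
  by apply: hermitian_normalmx; apply/is_hermitianmxP; rewrite expr0 scale1r AH.
set U := spectralmx _; set D := spectral_diag _ => AE.
have UU : U \is unitarymx by exact: spectral_unitarymx.
have iU := invmx_unitary UU.
have Uu : U \in unitmx by exact: spectral_unit.
have DE : diag_mx D = U *m A *m map_mx Num.conj U^T.
  by rewrite AE -iU !mulmxA mulmxV// mul1mx mulmxK.
have D0 i : 0 < D 0 i.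
  have /matrixP/(_ i i) := DE; rewrite !mxE eqxx mulr1n => ->.
  (* An eigenvector for [D 0 i]; the form of [A] at [x] is this eigenvalue. *)
  pose x : 'cV_n := map_mx Num.conj (row i U)^T.
  have xH : map_mx Num.conj x^T = row i U by rewrite /x trmxCK.
  have x0 : x != 0.
    apply/eqP => x0; have : row i (U *m invmx U) 0 i = 0.
      by rewrite row_mul -xH x0 trmx0 map_mx0 mul0mx mxE.
    by rewrite mulmxV// !mxE eqxx => /eqP; rewrite oner_eq0.
  have := A0 _ x0; rewrite xH -row_mul mxE; congr (0 < _).
  by apply: eq_bigr => j _; congr (_ * _); rewrite !mxE.
pose sD : 'rV_n := map_mx sqrtC D.
have sD0 i : 0 < sD 0 i by rewrite mxE sqrtC_gt0.
pose X := map_mx Num.conj U^T *m diag_mx sD *m U.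
have XX : X *m X = A.
  rewrite AE /X -iU !mulmxA mulmxK// -[in LHS](mulmxA (invmx U)).
  rewrite mulmx_diag; congr (_ *m diag_mx _ *m _); apply/rowP => i.
  by rewrite !mxE -expr2 sqrtCK.
have XH : map_mx Num.conj X^T = X.
  rewrite /X !trmx_mul !map_mxM -mulmxA -!map_trmx; congr (_ *m (_ *m _)).
    rewrite map_diag_mx tr_diag_mx; congr diag_mx; apply/rowP => i.
    by rewrite mxE; exact/conj_Creal/gtr0_real.
  apply/matrixP => i j; rewrite !mxE; exact: conjCK.
have X0 (x : 'cV_n) : x != 0 -> 0 < (map_mx Num.conj x^T *m X *m x) 0 0.
  (* In the coordinates [y] the form is the sum of the [sD 0 j * |y j 0|^2]. *)
  move=> x0; pose y := U *m x.
  have -> : map_mx Num.conj x^T *m X *m x = map_mx Num.conj y^T *m diag_mx sD *m y.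
    by rewrite /y /X trmx_mul map_mxM !mulmxA.
  have yE j : (map_mx Num.conj y^T *m diag_mx sD) 0 j * y j 0 = sD 0 j * `|y j 0| ^+ 2.
    by rewrite mul_mx_diag !mxE normCK mulrAC mulrC [_^* * _]mulrC.
  have [j yj0] : exists j, y j 0 != 0.
    apply/existsP; apply: contraT => /existsPn y0; case/eqP: x0.
    rewrite -[x](mulKmx Uu) -/y (_ : y = 0) ?mulmx0//.
    by apply/colP => j; rewrite [RHS]mxE; exact/eqP/negbNE/y0.
  rewrite mxE; under eq_bigr do rewrite yE.
  rewrite (bigD1 j)//= ltr_pwDl//; first by rewrite mulr_gt0// exprn_gt0 ?normr_gt0.
  by rewrite sumr_ge0// => k _; rewrite mulr_ge0 ?exprn_ge0// ltW.
by exists X.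
Qed.

End hermitian_sqrt.

(** * Descent of the square root to real matrices *)

Section complexification.
Context {R : realType} {n : nat}.
Local Notation toC := (@real_complex_def R (Phant R)).
Local Notation "A ^C" := (map_mx toC A) (at level 1, format "A ^C").

Lemma conjC_real_complex (x : R) : Num.conj (toC x) = toC x.
Proof. by apply/CrealP; apply/complex_realP; exists x. Qed.

Lemma map_conjC_real_complex m p (A : 'M[R]_(m, p)) : map_mx Num.conj A^C = A^C.
Proof. by apply/matrixP => i j; rewrite !mxE conjC_real_complex. Qed.

(** For [x = u + i v] the cross terms cancel by symmetry of [A], and the form at [x] is the sum of
    the forms at [u] and [v], which are not both 0. *)
Lemma posdef_real_complex (A : 'M[R]_n) : posdefmx A ->
  hermposdefmx A^C.
Proof.
move=> [AT A0]; split; first by rewrite -map_trmx map_conjC_real_complex map_trmx AT.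
move=> x x0; pose u := map_mx (@complex.Re R) x; pose v := map_mx (@complex.Im R) x.
have xE : x = u^C + 'i%C *: v^C.
  by apply/matrixP => i j; rewrite !mxE -complexE.
clearbody u v.
have -> : (map_mx Num.conj x^T *m A^C *m x) 0 0 =
    toC ((u^T *m A *m u) 0 0 + (v^T *m A *m v) 0 0).
  have xs : map_mx Num.conj x^T = u^T^C - 'i%C *: v^T^C.
    rewrite xE linearD linearZ/= map_mxD map_mxZ/= -!map_trmx !map_conjC_real_complex.
    by rewrite conjCi scaleNr !map_trmx.
  have uv : v^T *m A *m u = u^T *m A *m v.
    have -> : v^T *m A *m u = (u^T *m A *m v)^T by rewrite !trmx_mul trmxK AT mulmxA.
    by apply/matrixP => i j; rewrite mxE !ord1.
  rewrite xs {1}xE !(mulmxDr, mulmxDl) !mulNmx -!(scalemxAl, scalemxAr) -!map_mxM/=.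
  rewrite uv; set a := (u^T *m A *m u); set b := (v^T *m A *m v).
  set e := (u^T *m _ *m _).
  rewrite addrA subrK scalerA -expr2 sqr_i scaleN1r opprK !mxE.
  by rewrite [RHS]rmorphD.
rewrite ltcR.
have ge0 (y : 'cV_n) : 0 <= (y^T *m A *m y) 0 0.
  by have [->|/A0/ltW//] := eqVneq y 0; rewrite mulmx0 mxE.
have [u0|/A0 ?] := eqVneq u 0; last exact: ltr_pwDl.
apply: ltr_wpDl => //; apply: A0; apply: contra_neq x0 => v0.
by rewrite xE u0 v0 !map_mx0 scaler0 addr0.
Qed.

(* The conjugate of the square root of the complexified matrix is another square
   root of it, so that the square root is real. *)
Lemma posdef_sqrt_exists (A : 'M[R]_n) : posdefmx A ->
  exists B, posdefmx B /\ B *m B = A.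
Proof.
move=> /posdef_real_complex/hermposdefmx_sqrt_exists[X X_pd XX].
have Xreal : map_mx Num.conj X = X.
  apply: hermposdefmx_sqrt_unique => //; first exact: hermposdefmx_conj.
  have -> : map_mx Num.conj X *m map_mx Num.conj X = map_mx Num.conj (X *m X).
    exact/esym/(map_mxM Num.conj).
  by rewrite XX map_conjC_real_complex.
have [XH X0] := X_pd.
pose B : 'M[R]_n := map_mx (@complex.Re R) X.
have BX : B^C = X.
  apply/matrixP => i j; rewrite !mxE; apply: RRe_real; apply/CrealP.
  by move/matrixP/(_ i j) : Xreal; rewrite mxE.
exists B; split; last by apply: (map_mx_inj (f := toC)); rewrite map_mxM BX.
split.
  apply: (map_mx_inj (f := toC)).
  by rewrite -map_trmx BX -{2}XH -map_trmx; congr trmx; rewrite Xreal.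
move=> x x0; have x0' : x^C != 0 by rewrite map_mx_eq0.
have := X0 _ x0'.
by rewrite -BX -map_trmx map_conjC_real_complex map_trmx -!map_mxM mxE ltcR.
Qed.

End complexification.

(** * Real positive definite matrices and invariance under orthogonal conjugation *)

Section posdef.
Context {R : realType} {n : nat}.
Implicit Types A B C M S O : 'M[R]_n.

(** A nonzero row [v] with [v A = 0] would make the form of [A] vanish at [v^T]. *)
Lemma posdefmx_unit A : posdefmx A -> A \in unitmx.
Proof.
move=> [_ A0]; rewrite -row_free_unit -kermx_eq0; apply: contraT => /rowV0Pn[v].
move=> /sub_kermxP vA v0; have /A0 : v^T != 0 by rewrite trmx_eq0.
by rewrite trmxK vA mul0mx mxE ltxx.
Qed.

Lemma posdefmx_congr A S : A \in unitmx -> posdefmx S -> posdefmx (A *m S *m A^T).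
Proof.
move=> Au [ST S0]; split; first by rewrite !trmx_mul trmxK ST mulmxA.
move=> x x0; have : A^T *m x != 0.
  apply: contra_neq x0 => /(congr1 (mulmx (invmx A^T))).
  by rewrite mulKmx ?unitmx_tr// mulmx0.
by move/S0; rewrite trmx_mul trmxK !mulmxA.
Qed.

Lemma posdefmx_scale c A : 0 < c -> posdefmx A -> posdefmx (c *: A).
Proof.
move=> c0 [AT A0]; split; first by rewrite linearZ/= AT.
by move=> x /A0 ?; rewrite -scalemxAr -scalemxAl mxE mulr_gt0.
Qed.

Lemma posdefmx1 : posdefmx (1%:M : 'M[R]_n).
Proof.
split=> [|x x0]; first exact: trmx1.
rewrite mulmx1 mxE; under eq_bigr do rewrite mxE -expr2.
rewrite lt_neqAle sumr_ge0 ?andbT 1?eq_sym//; last by move=> i _; exact: sqr_ge0.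
rewrite psumr_eq0//; last by move=> i _; exact: sqr_ge0.
apply: contra x0 => /allP x0; apply/eqP/colP => i; rewrite mxE; apply/eqP.
by rewrite -sqrf_eq0; apply: x0; rewrite mem_index_enum.
Qed.

Lemma posdefmx_diag_gt0 A i : posdefmx A -> 0 < A i i.
Proof.
move=> [_ A0]; have /A0 : (delta_mx i 0 : 'cV[R]_n) != 0.
  by apply/eqP => /matrixP/(_ i 0); rewrite !mxE !eqxx => /eqP; rewrite oner_eq0.
by rewrite -mulmxA -colE trmx_delta -rowE !mxE.
Qed.

(** A root exists, so [xget] returns one and not its default value 0. *)
Lemma sqrtmxP A : posdefmx A ->
  posdefmx (sqrtmx A) /\ sqrtmx A *m sqrtmx A = A.
Proof. by move=> /posdef_sqrt_exists; exact: xgetPex. Qed.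

(** [A = B 1 B^T] is positive definite as a congruence of the identity; uniqueness of square roots
    then applies, with the trivial involution. *)
Lemma sqrtmx_eq A B : posdefmx B -> B *m B = A -> sqrtmx A = B.
Proof.
move=> B_pd BA; have A_pd : posdefmx A.
  have := posdefmx_congr (posdefmx_unit B_pd) posdefmx1.
  by rewrite mulmx1 B_pd.1 BA.
have [sA_pd sA] := sqrtmxP A_pd.
apply: (@posdef_sqrt_unique R idfun); rewrite ?sA ?BA//.
- by rewrite map_mx_id// sA_pd.1.
- by rewrite map_mx_id// B_pd.1.
- by move=> x x0; rewrite map_mx_id//; exact: sA_pd.2.
- by move=> x x0; rewrite map_mx_id//; exact: B_pd.2.
Qed.

Lemma sqrtmx1 : sqrtmx (1%:M : 'M[R]_n) = 1%:M.
Proof. by apply: sqrtmx_eq; [exact: posdefmx1|rewrite mul1mx]. Qed.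

Lemma sqrtmx_scale c A : 0 < c -> posdefmx A ->
  sqrtmx (c *: A) = Num.sqrt c *: sqrtmx A.
Proof.
move=> c0 /sqrtmxP[sA_pd sA]; apply: sqrtmx_eq.
  by apply: posdefmx_scale => //; rewrite sqrtr_gt0.
by rewrite -scalemxAr -scalemxAl scalerA -expr2 sqr_sqrtr ?ltW// sA.
Qed.

Lemma posdefmx_diagmx A : posdefmx A -> posdefmx (diagmx A).
Proof.
move=> A_pd; split=> [|x x0]; first exact: tr_diag_mx.
rewrite mxE.
have xE i : (x^T *m diagmx A) 0 i * x i 0 = A i i * x i 0 ^+ 2.
  by rewrite mul_mx_diag !mxE expr2 mulrCA mulrA.
under eq_bigr do rewrite xE.
have ge0 i : 0 <= A i i * x i 0 ^+ 2.
  by rewrite mulr_ge0 ?sqr_ge0// ltW// posdefmx_diag_gt0.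
rewrite lt_neqAle sumr_ge0 ?andbT 1?eq_sym//.
rewrite psumr_eq0//; apply: contra x0 => /allP x0.
apply/eqP/colP => i; rewrite mxE; apply/eqP.
have /eqP/eqP := x0 i (mem_index_enum i).
by rewrite mulf_eq0 sqrf_eq0 gt_eqF//= posdefmx_diag_gt0.
Qed.

(** The two outer factors each contribute the inverse of [Num.sqrt c], which cancels [c]. *)
Lemma normalise_diag_scale c A : 0 < c -> posdefmx A ->
  normalise_diag (c *: A) = normalise_diag A.
Proof.
move=> c0 A_pd; rewrite /normalise_diag.
have -> : diagmx (c *: A) = c *: diagmx A.
  by rewrite /diagmx -linearZ/=; congr diag_mx; apply/rowP => i; rewrite !mxE.
have D_pd := posdefmx_diagmx A_pd.
have sc0 : Num.sqrt c \is a GRing.unit by rewrite unitfE gt_eqF ?sqrtr_gt0.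
rewrite sqrtmx_scale// invmxZ ?unitmxZ//; last first.
  by apply: posdefmx_unit; have [] := sqrtmxP D_pd.
rewrite -!(scalemxAl, scalemxAr) !scalerA.
rewrite (_ : _ * _ = 1) ?scale1r//.
move: (sqr_sqrtr (ltW c0)) sc0; move: (Num.sqrt c) => s <-; rewrite unitfE => s0.
by field.
Qed.

(* Sign changes kill the off-diagonal entries, transpositions identify the
   diagonal ones. *)
Lemma orthogonal_invariant_scalar K (i0 : 'I_n) :
  (forall O, orthogonalmx O -> O *m K *m O^T = K) -> K = (K i0 i0)%:M.
Proof.
move=> inv; apply/matrixP => i j; rewrite [RHS]mxE.
have [<-|ij] := eqVneq i j; rewrite ?mulr1n ?mulr0n.
  have /inv/matrixP/(_ i i) : orthogonalmx (tperm_mx i i0 : 'M[R]_n).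
    by rewrite /orthogonalmx tr_tperm_mx -perm_mxM tperm2 perm_mx1.
  by rewrite tr_tperm_mx -xcolE -xrowE !mxE tpermL.
pose D : 'rV[R]_n := \row_k (if k == i then -1 else 1).
have /inv/matrixP/(_ i j) : orthogonalmx (diag_mx D).
  rewrite /orthogonalmx tr_diag_mx mulmx_diag -diag_const_mx; congr diag_mx.
  by apply/rowP => k; rewrite !mxE; case: ifP; rewrite ?mulrNN mulr1.
rewrite tr_diag_mx mul_mx_diag mul_diag_mx !mxE eqxx eq_sym (negbTE ij) mulr1.
by rewrite mulN1r => /eqP; rewrite eqNr => /eqP.
Qed.

(** With [B] the root of [M], the matrix [K = B^-1 S B^-1] is invariant under orthogonal
    conjugation, hence scalar, and [S = B K B] is that scalar times [B B = M]. *)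
Lemma congr_invariant_scale M S (i0 : 'I_n) : posdefmx M ->
  (forall O, orthogonalmx O ->
    let A := sqrtmx M *m O *m invmx (sqrtmx M) in A *m S *m A^T = S) ->
  exists l, S = l *: M.
Proof.
move=> /sqrtmxP[]; set B := sqrtmx M => B_pd BM inv.
have Bu := posdefmx_unit B_pd.
have iBT : (invmx B)^T = invmx B by rewrite trmx_inv B_pd.1.
pose K := invmx B *m S *m invmx B.
have SE : S = B *m K *m B by rewrite /K !mulmxA mulmxKV// mulmxV// mul1mx.
exists (K i0 i0); rewrite SE [K in LHS](@orthogonal_invariant_scalar _ i0).
  by rewrite mul_mx_scalar -scalemxAl BM.
move=> O /inv/=; rewrite !trmx_mul iBT B_pd.1 => H.
by rewrite {2}/K -H !mulmxA mulVmx// mul1mx mulmxK//.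
Qed.

End posdef.

(** * Transport of f-divergences *)

(* The sublevel sets of a convex function are intervals. *)
Lemma measurable_fdiv_ext (R : realType) (f : R -> R) :
  @convex_function R R^o `]0, +oo[%classic f ->
  measurable_fun [set: R] (fdiv_ext f).
Proof.
move=> f_convex; apply: measurable_fun_if => //; first exact: measurable_fun_ltr.
have -> : setT `&` (fun t : R => (0 < t)%R) @^-1` [set true] = `]0%R, +oo[%classic.
  by apply/seteqP; split=> t /=; rewrite in_itv/= andbT => // -[].
apply/measurable_EFinP/(measurability (@RGenInftyO.G R)).
  exact: RGenInftyO.measurableE.
move=> /= _ [_] [r] -> <-.
apply: is_interval_measurable => s t/=.
rewrite !in_itv/= !andbT => -[s0 fs] [t0 ft] u /andP[su ut].
rewrite !in_itv/= andbT; split; first exact: lt_le_trans su.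
have [st|ts] := ltP s t; last first.
  by rewrite (_ : u = s)//; apply/le_anti; rewrite su (le_trans ut).
have ts0 : 0 < t - s by rewrite subr_gt0.
(* The weight of [s] when [u] is written as a convex combination of [s] and [t]. *)
pose k : R := (t - u) / (t - s).
have k0 : 0 <= k by rewrite divr_ge0 ?subr_ge0// ltW.
have k1 : k <= 1 by rewrite ler_pdivrMr// mul1r lerD2l lerN2.
have uE : u = k * s + (1 - k) * t by rewrite /k; field; rewrite gt_eqF.
have := f_convex (Itv01 k0 k1) s t.
rewrite !inE/= !in_itv/= !andbT => /(_ s0 t0) fu.
apply: le_lt_trans (_ : k * f s + (1 - k) * f t < r); first by rewrite [in leLHS]uE.
have k1' : 0 <= 1 - k by rewrite subr_ge0.
have -> : r = k * r + (1 - k) * r by ring.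
(* For [k > 0] strictness comes from [f s < r]; for [k = 0] it comes from [f t < r]. *)
have [->|kn0] := eqVneq k 0%R; first by rewrite !mul0r !add0r subr0 !mul1r.
have {}kn0 : 0 < k by rewrite lt_neqAle eq_sym kn0.
by rewrite ltr_leD ?ltr_pM2l// ler_wpM2l// ltW.
Qed.

Section fdiv_transport.
Context d (T : measurableType d) (R : realType).
Variable f : R -> R.
Hypothesis f_convex : @convex_function R R^o `]0, +oo[%classic f.
Variables (phi psi : T -> T).
Hypotheses (mphi : measurable_fun setT phi) (mpsi : measurable_fun setT psi).
Hypothesis phiK : cancel phi psi.
Variables (P Q P' Q' : probability T R).
Hypothesis P'E : forall A, measurable A -> P' A = P (phi @^-1` A).
Hypothesis Q'E : forall A, measurable A -> Q' A = Q (phi @^-1` A).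
Local Open Scope ereal_scope.

(** [Radon_Nikodym_SigmaFinite.f] is finite and nonnegative at every point, as [is_density] demands,
    and not only almost everywhere. *)
Let density_exists (lam : {sigma_finite_measure set T -> \bar R})
    (nu : probability T R) : nu `<< lam -> exists p, is_density lam nu p.
Proof.
move=> nulam; pose p x := fine (Radon_Nikodym_SigmaFinite.f nu lam x).
have pE x : (p x)%:E = Radon_Nikodym_SigmaFinite.f nu lam x.
  by rewrite fineK// Radon_Nikodym_SigmaFinite.f_fin_num.
exists p; split=> [|x|A mA].
- apply/measurable_EFinP; rewrite (_ : _ \o _ = Radon_Nikodym_SigmaFinite.f nu lam).
    exact: measurable_int (Radon_Nikodym_SigmaFinite.f_integrable nulam).
  exact/funext.
- by rewrite -lee_fin pE Radon_Nikodym_SigmaFinite.f_ge0.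
- rewrite (Radon_Nikodym_SigmaFinite.f_integral nulam)//.
  by apply: eq_integral => x _; rewrite pE.
Qed.

Let lam := measure_add P Q.
Let lam' := measure_add P' Q'.

Let lam'E A : measurable A -> lam' A = pushforward lam phi A.
Proof.
move=> mA; rewrite /pushforward [LHS]measure_addE [RHS]measure_addE.
by congr (_ + _); [exact: P'E|exact: Q'E].
Qed.

Let ge0_transport D (g : T -> \bar R) : measurable D -> measurable_fun D g ->
  (forall x, D x -> 0 <= g x) ->
  \int[lam']_(x in D) g x = \int[lam]_(x in phi @^-1` D) g (phi x).
Proof.
move=> mD mg g0.
rewrite (eq_measure_integral (pushforward lam phi)); last by move=> A mA _; exact: lam'E.
by rewrite ge0_integral_pushforward// => x; rewrite inE; exact: g0.
Qed.

(** The divergence integrand may change sign and have an infinite integral, so positive and negative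
    parts are transported separately. *)
Let transport D (g : T -> \bar R) : measurable D -> measurable_fun D g ->
  \int[lam']_(x in D) g x = \int[lam]_(x in phi @^-1` D) g (phi x).
Proof.
move=> mD mg; rewrite integralE [RHS]integralE.
congr (_ - _); rewrite ge0_transport//.
- by apply: eq_integral => x _; rewrite !funeposE.
- exact: measurable_funepos.
- by apply: eq_integral => x _; rewrite !funenegE.
- exact: measurable_funeneg.
Qed.

(** Since [psi] inverts [phi], every measurable [A] is the [phi]-preimage of the measurable set
    [psi @^-1] A[, on which]p[integrates to]nu' (psi @^-1[A) = nu A]. *)
Let density_comp (nu nu' : probability T R) p :
  (forall A, measurable A -> nu' A = nu (phi @^-1` A)) ->
  is_density lam' nu' p -> is_density lam nu (p \o phi).
Proof.
move=> nu'E [mp p0 pE]; split=> [|x|A mA].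
- exact: measurableT_comp.
- exact: p0.
have mpsiA : measurable (psi @^-1` A) by rewrite -[X in measurable X]setTI; exact: mpsi.
have phipsi : phi @^-1` (psi @^-1` A) = A.
  by apply/seteqP; split=> x /=; rewrite phiK.
rewrite -{1}phipsi -nu'E// pE// ge0_transport ?phipsi//.
  exact/measurable_EFinP/measurable_funTS.
by move=> x _; rewrite lee_fin.
Qed.

(** Densities [p], [q] of [P'], [Q'] pull back to densities of [P], [Q]. By [fdivE] both divergences
    may be computed from these, and a change of variables matches the two expressions. *)
Lemma fdiv_transport : fdiv f P' Q' = fdiv f P Q.
Proof.
have addE A : lam' A = P' A + Q' A by exact: measure_addE.
have [p pd] : exists p, is_density lam' P' p.
  apply: density_exists; apply/null_content_dominatesP => A mA /eqP.
  by rewrite [X in X == _]addE padde_eq0// => /andP[/eqP].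
have [q qd] : exists q, is_density lam' Q' q.
  apply: density_exists; apply/null_content_dominatesP => A mA /eqP.
  by rewrite [X in X == _]addE padde_eq0// => /andP[_ /eqP].
rewrite (fdivE f_convex pd qd).
rewrite (fdivE f_convex (density_comp P'E pd) (density_comp Q'E qd)).
have [mp p0 _] := pd; have [mq q0 _] := qd.
have mq0 : measurable [set x | (0 < q x)%R].
  have mq0 : measurable_fun setT (fun x => (0 < q x)%R) by exact: measurable_fun_ltr.
  by rewrite -[X in measurable X]setTI; exact: (mq0 measurableT [set true]).
rewrite /fdiv_wrt; congr (_ + _ * _).
  rewrite transport//; apply: emeasurable_funM.
    exact/measurable_EFinP/measurable_funTS.
  apply: (measurableT_comp (measurable_fdiv_ext f_convex)).
  apply: measurable_funM; first exact: measurable_funTS.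
  (* On the set where [q] is positive the inverse is a real power, which is measurable. *)
  apply: (eq_measurable_fun (fun x => q x `^ (-1))%R).
    by move=> x; rewrite inE /= => qx; rewrite powR_inv1// ltW.
  by apply: measurable_funTS; exact: (measurableT_comp (measurable_powR _) mq).
rewrite P'E// -[X in measurable X]setTI.
exact: (mq measurableT [set 0%R]).
Qed.

End fdiv_transport.

(** * Moments of affine images *)

(** The index is any finite type, so that pairs of coordinates serve for covariances as single ones
    do for means. *)
Lemma integral_lincomb d (T : measurableType d) (R : realType)
    (mu : {measure set T -> \bar R}) (I : finType) (c : I -> R)
    (h : I -> T -> R) :
  (forall i, mu.-integrable setT (EFin \o h i)) ->
  mu.-integrable setT (fun x => (\sum_i c i * h i x)%:E) /\
  fine (\int[mu]_x (\sum_i c i * h i x)%:E)%E =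
    \sum_i c i * fine (\int[mu]_x (h i x)%:E)%E.
Proof.
move=> ih; have ich i : mu.-integrable setT (fun x => (c i)%:E * (h i x)%:E)%E.
  exact: (integrableZl measurableT (c i) (ih i)).
have E : (fun x => (\sum_i c i * h i x)%:E) = (fun x => \sum_i (c i)%:E * (h i x)%:E)%E.
  by apply/funext => x; rewrite -sumEFin; apply: eq_bigr => i _; rewrite EFinM.
rewrite E; split; first exact: integrable_sum.
rewrite integral_sum//.
transitivity (fine (\sum_i (c i * fine (\int[mu]_x (h i x)%:E)%E)%:E)%E).
  congr fine; apply: eq_bigr => i _; rewrite EFinM fineK.
    exact: (integralZl measurableT (ih i)).
  exact: (integrable_fin_num measurableT (ih i)).
by rewrite sumEFin.
Qed.

Section moments.
Context {R : realType} {d : nat}.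
Local Notation T := (borelRd R d).
Local Notation coord := (@Defs.coord R d).
Implicit Types (P : probability T R) (A : 'M[R]_d) (g : 'cV[R]_d).

Lemma continuous_measurable_borelRd (h : 'cV[R]_d -> R) : continuous h ->
  measurable_fun (setT : set T) h.
Proof.
move=> ch; apply: (measurability _ (RGenOpens.measurableE R)).
move=> _ [_ [a [b ->] <-]]; rewrite setTI; apply: sub_sigma_algebra.
by apply: open_comp => [x _|]; [exact: ch|exact: interval_open].
Qed.

Lemma measurable_coord i : measurable_fun (setT : set T) (coord i).
Proof. by apply: continuous_measurable_borelRd; exact: coord_continuous. Qed.

Lemma measurable_affine g A :
  measurable_fun (setT : set T) (fun x : T => g + A *m x : T).
Proof.
apply: (@measurability _ _ T T setT _ (@open 'cV[R]_d)) => //.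
move=> _ [B oB <-]; rewrite setTI; apply: sub_sigma_algebra.
by apply: open_comp oB => x _; exact: continuous_affine.
Qed.

Lemma measurable_enorm : measurable_fun (setT : set T) (@enorm R d).
Proof.
rewrite (_ : enorm (d:=d) = Num.sqrt \o (fun x : T => \sum_i coord i x ^+ 2))//.
apply: measurableT_comp.
  by apply: continuous_measurable_fun; exact: sqrt_continuous.
apply: measurable_sum => i; apply: measurable_funX; exact: measurable_coord.
Qed.

Lemma enorm_ge0 (x : 'cV[R]_d) : 0 <= enorm x.
Proof. exact: sqrtr_ge0. Qed.

Lemma le_enorm i (x : 'cV[R]_d) : `|coord i x| <= enorm x.
Proof.
rewrite -sqrtr_sqr ler_wsqrtr// (bigD1 i)//= lerDl sumr_ge0// => j _.
exact: sqr_ge0.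
Qed.

Lemma finite_moment_integrable n P : finite_moment n P ->
  P.-integrable setT (fun x => (enorm x ^+ n)%:E).
Proof.
move=> Pn; apply/integrableP; split.
  by apply/measurable_EFinP/measurable_funX; exact: measurable_enorm.
under eq_integral do rewrite gee0_abs ?lee_fin ?exprn_ge0 ?enorm_ge0//.
exact: Pn.
Qed.

Lemma integrable_coord P i : finite_moment 1 P ->
  P.-integrable setT (EFin \o coord i).
Proof.
move/finite_moment_integrable; apply: le_integrable => //.
  by apply/measurable_EFinP; exact: measurable_coord.
by move=> x _; rewrite /= lee_fin (ger0_norm (enorm_ge0 _)) le_enorm.
Qed.

(** Domination: [r <= 1 + r^2], with the cases [r <= 1] and [r > 1] taken apart. *)
Lemma finite_moment21 P : finite_moment 2 P -> finite_moment 1 P.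
Proof.
move=> /finite_moment_integrable P2.
have i1 : P.-integrable setT (fun x => 1 + (enorm x ^+ 2)%:E)%E.
  by apply: integrableD => //; exact: finite_measure_integrable_cst.
rewrite /finite_moment; apply: le_lt_trans (integrable_lty measurableT i1).
apply: ge0_le_integral => //.
- by move=> x _; rewrite lee_fin enorm_ge0.
- by apply/measurable_EFinP/measurable_funX; exact: measurable_enorm.
- exact: measurable_int i1.
- move=> x _; rewrite -EFinD lee_fin expr1.
  have [e1|/ltW e1] := leP (enorm x) 1; first by rewrite (le_trans e1)// lerDl sqr_ge0.
  by rewrite (le_trans (ler_eXnr _ e1) (_ : _ ^+ 2 <= _))// lerDr.
Qed.

Lemma integrable_coordM P i j (a b : R) : finite_moment 2 P ->
  P.-integrable setT (fun x => ((coord i x - a) * (coord j x - b))%:E).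
Proof.
move=> P2; have P1 := finite_moment21 P2.
have ic c k : P.-integrable setT (fun x => (c * coord k x)%:E).
  exact: (integrableZl measurableT c (integrable_coord k P1)).
have ij : P.-integrable setT (fun x => (coord i x * coord j x)%:E).
  apply: le_integrable (finite_moment_integrable P2) => //.
    by apply/measurable_EFinP/measurable_funM; exact: measurable_coord.
  move=> x _; rewrite /= lee_fin normrM [leRHS]ger0_norm ?exprn_ge0 ?enorm_ge0//.
  by rewrite expr2 ler_pM ?le_enorm.
have iab : P.-integrable setT (fun=> (a * b)%:E) by exact: finite_measure_integrable_cst.
rewrite (_ : (fun x => _) = (fun x => (coord i x * coord j x)%:E + (- b * coord i x)%:E
  + (- a * coord j x)%:E + (a * b)%:E)%E); last first.
  by apply/funext => x; rewrite -!EFinD; congr EFin; ring.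
by do 3 (apply: integrableD => //).
Qed.

Lemma covmxE P i j : covmx P i j = fine (\int[P]_x
  ((coord i x - mean P i 0) * (coord j x - mean P j 0))%:E)%E.
Proof.
rewrite mxE unlock; congr fine; rewrite expectation.unlock.
by apply: eq_integral => x _; rewrite !mxE expectation.unlock.
Qed.

(** * Mean and covariance under an affine map *)

Section affine_image.
Variables (P P' : probability T R) (g : 'cV[R]_d) (A : 'M[R]_d).
Hypothesis P'E : Defs.eq_measure P' (pushforward P (fun x : T => g + A *m x : T)).

Let integral_affine (h : T -> R) : measurable_fun setT h ->
  P.-integrable setT (fun x => (h (g + A *m x))%:E) ->
  (\int[P']_x (h x)%:E = \int[P]_x (h (g + A *m x))%:E)%E.
Proof.
move=> mh ih; have mA := measurable_affine g A.
rewrite (eq_measure_integral (pushforward P (fun x : T => g + A *m x : T))) => [|B mB _].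
  by rewrite integral_pushforward//; exact/measurable_EFinP.
exact: P'E.
Qed.

Lemma mean_affine : finite_moment 1 P -> mean P' = g + A *m mean P.
Proof.
move=> P1; apply/colP => i; rewrite mxE unlock.
have [iA EA] := integral_lincomb (A i) (fun j => integrable_coord j P1).
have ig : P.-integrable setT (fun=> (g i 0)%:E) by exact: finite_measure_integrable_cst.
have E x : (coord i (g + A *m x))%:E = ((g i 0)%:E + (\sum_j A i j * coord j x)%:E)%E.
  by rewrite /coord !mxE.
rewrite integral_affine; first last.
- by under eq_fun do rewrite E; exact: integrableD.
- exact: measurable_coord.
under eq_integral do rewrite E.
rewrite integralD// integral_cst//= probability_setT mule1.
rewrite fineD//; last exact: integrable_fin_num.
rewrite EA !mxE; congr (_ + _); apply: eq_bigr => j _.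
by rewrite mxE unlock.
Qed.

Lemma covmx_affine : finite_moment 2 P -> covmx P' = A *m covmx P *m A^T.
Proof.
move=> P2; have mu' := mean_affine (finite_moment21 P2).
pose h (kl : 'I_d * 'I_d) x :=
  (coord kl.1 x - mean P kl.1 0) * (coord kl.2 x - mean P kl.2 0).
apply/matrixP => i j; rewrite covmxE.
have ih kl : P.-integrable setT (EFin \o h kl) by exact: integrable_coordM.
have [iA EA] := integral_lincomb (fun kl : 'I_d * 'I_d => A i kl.1 * A j kl.2) ih.
(* Centring cancels the translation [g], so the products below are quadratic in the centred
   coordinates. *)
have centered k x : coord k (g + A *m x) - mean P' k 0 =
    \sum_l A k l * (coord l x - mean P l 0).
  rewrite mu' /coord !mxE opprD addrACA subrr add0r -sumrB.
  by apply: eq_bigr => l _; rewrite mulrBr.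
have E x : ((coord i (g + A *m x) - mean P' i 0) *
    (coord j (g + A *m x) - mean P' j 0))%:E =
    (\sum_kl A i kl.1 * A j kl.2 * h kl x)%:E.
  rewrite !centered mulr_suml; congr EFin.
  under eq_bigr do rewrite mulr_sumr.
  by rewrite pair_bigA/=; apply: eq_bigr => kl _; rewrite mulrACA.
rewrite (@integral_affine (fun x =>
  (coord i x - mean P' i 0) * (coord j x - mean P' j 0))); first last.
- by under eq_fun do rewrite E.
- by apply: measurable_funM; apply: measurable_funB => //; exact: measurable_coord.
under eq_integral do rewrite E.
rewrite EA -(pair_bigA _ (fun k l =>
  A i k * A j l * fine (\int[P]_x (h (k, l) x)%:E)%E))/=.
rewrite exchange_big mxE; apply: eq_bigr => l _/=.
rewrite !mxE mulr_suml; apply: eq_bigr => k _.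
by rewrite covmxE mulrAC.
Qed.

End affine_image.

(** Zero variance makes each coordinate almost surely equal to its mean; the coordinates being
    finitely many, the whole vector is almost surely [mean P]. *)
Lemma covmx_eq0_dirac P : finite_moment 2 P -> covmx P = 0 -> is_dirac P.
Proof.
move=> P2 cov0; exists (mean P : T).
have [N [mN PN0 NE]] : {ae P, forall x : T, x = mean P :> 'cV[R]_d}.
  have ae_coord i : {ae P, forall x : T, coord i x = mean P i 0}.
    have := covmxE P i i; rewrite cov0 mxE => E.
    have ii := integrable_coordM i i (mean P i 0) (mean P i 0) P2.
    have : (\int[P]_x `|((coord i x - mean P i 0) * (coord i x - mean P i 0))%:E| = 0)%E.
      under eq_integral do rewrite gee0_abs ?lee_fin -?expr2 ?sqr_ge0//.
      by rewrite -[LHS]fineK ?integrable_fin_num// -E.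
    move/(ae_eq_integral_abs P measurableT (measurable_int _ ii)).
    apply: filterS => x /(_ I) /= [] /eqP.
    by rewrite mulf_eq0 orbb subr_eq0 => /eqP.
  apply: filterS (filter_forall _ ae_coord) => x xE.
  by apply/colP => i; exact: xE.
move=> A mA; rewrite diracE.
have [Amu|Amu] := boolP (mean P \in A); last first.
  apply: (subset_measure0 mA mN _ PN0) => x Ax; apply: NE => xmu.
  by move: Amu; rewrite -xmu mem_set.
have PC0 : P (~` A) = 0%E.
  apply: (subset_measure0 (measurableC mA) mN _ PN0) => x Ax; apply: NE => xmu.
  by apply: Ax; rewrite xmu; exact: set_mem.
by rewrite -[A]setCK probability_setC ?PC0 ?sube0//; exact: measurableC.
Qed.

Lemma covmx_diag_ge0 P i : 0 <= covmx P i i.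
Proof.
rewrite covmxE; apply: fine_ge0; apply: integral_ge0 => x _.
by rewrite lee_fin -expr2 sqr_ge0.
Qed.

End moments.

(** * Symmetries of the minimisation problem *)

Section symmetry.
Context {R : realType} {d : nat}.
Local Notation T := (borelRd R d).
Local Notation affine g A := (fun x : T => g + A *m x : T).
Implicit Types (P Q : probability T R) (A M S O : 'M[R]_d) (g m nu : 'cV[R]_d).

Lemma measurable_preimage_affine g A (B : set T) :
  measurable B -> measurable (affine g A @^-1` B).
Proof. by move=> mB; rewrite -[X in measurable X]setTI; exact: measurable_affine. Qed.

(** For [B] the root of [M], the map sends [m + B x] to [m + B (O x)], and [P0] is invariant under
    [O]. *)
Lemma elliptic_invariant P m M O :
  posdefmx M -> orthogonalmx O -> elliptically_symmetric P m M ->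
  let A := sqrtmx M *m O *m invmx (sqrtmx M) in
  Defs.eq_measure P (pushforward P (affine (m - A *m m) A)).
Proof.
move=> /sqrtmxP[/posdefmx_unit Bu _] oO [P0 P0inv PE] A B mB.
have mAB := measurable_preimage_affine (m - A *m m) A mB.
rewrite [RHS]PE// PE// /pushforward.
have mMB := measurable_preimage_affine m (sqrtmx M) mB.
rewrite -[LHS](P0inv O oO)//; congr (P0 _).
apply/seteqP; split=> x; rewrite /= /loc_scale_map mulmxDr -addrA addKr;
  by rewrite !mulmxA /A mulmxKV.
Qed.

Lemma loc_scale_affine Q g A nu S : Od_invariant Q -> A \in unitmx -> posdefmx S ->
  Defs.eq_measure (loc_scale Q (g + A *m nu) (A *m S *m A^T))
             (pushforward (loc_scale Q nu S) (affine g A)).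
Proof.
move=> Qinv Au S_pd B mB; have S'_pd := posdefmx_congr Au S_pd.
have [B_pd BS] := sqrtmxP S_pd; have [B'_pd B'S] := sqrtmxP S'_pd.
set S' := A *m S *m A^T in S'_pd B'_pd B'S *.
have B'u := posdefmx_unit B'_pd.
have iB'T : (invmx (sqrtmx S'))^T = invmx (sqrtmx S') by rewrite trmx_inv B'_pd.1.
pose O := invmx (sqrtmx S') *m A *m sqrtmx S.
have oO : orthogonalmx O.
  (* [O O^T] is [S'] flanked by two inverse roots of [S'], hence 1; [mulmx1C] passes to [O^T O]. *)
  apply: mulmx1C; rewrite /O !trmx_mul iB'T B_pd.1 !mulmxA.
  rewrite -(mulmxA _ (sqrtmx S) (sqrtmx S)) BS -(mulmxA _ A S) -(mulmxA _ (A *m S)).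
  by rewrite -/S' -[X in _ *m X *m _]B'S mulmxA mulVmx// mul1mx mulmxV.
rewrite /pushforward/= /distribution/= /pushforward.
have mB' := measurable_preimage_affine (g + A *m nu) (sqrtmx S') mB.
rewrite -[LHS](Qinv O oO)//; congr (Q _).
by apply/seteqP; split=> x;
  rewrite /= /loc_scale_map /O !mulmxA mulmxV// mul1mx mulmxDr !mulmxA !addrA.
Qed.

Lemma fdiv_affine (f : R -> R) P P' Q Q' g A :
  @convex_function R R^o `]0, +oo[%classic f -> A \in unitmx ->
  Defs.eq_measure P' (pushforward P (affine g A)) ->
  Defs.eq_measure Q' (pushforward Q (affine g A)) ->
  fdiv f P' Q' = fdiv f P Q.
Proof.
move=> f_convex Au P'E Q'E.
apply: (@fdiv_transport _ _ _ _ f_convex (affine g A)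
  (affine (- (invmx A *m g)) (invmx A))) => //.
- exact: measurable_affine.
- exact: measurable_affine.
- by move=> x /=; rewrite mulmxDr addrA addNr add0r mulKmx.
Qed.

Lemma orthogonalmxN1 : orthogonalmx (- 1%:M : 'M[R]_d).
Proof. by rewrite /orthogonalmx mulmxN mulmx1 linearN/= opprK trmx1. Qed.

(** [B] equals -1, so the equation reads [2 m - x = x]. It serves both the location of the minimiser
    and the mean of [P]. *)
Lemma reflection_fixpoint A (x m : 'cV[R]_d) : A \in unitmx ->
  let B := A *m - 1%:M *m invmx A in m - B *m m + B *m x = x -> x = m.
Proof.
move=> Au /=; rewrite mulmxN mulmx1 mulNmx mulmxV// !mulNmx !mul1mx opprK => /eqP.
rewrite subr_eq => /eqP mx; apply/colP => i.
have /eqP := congr1 (fun y : 'cV[R]_d => y i 0) mx.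
by rewrite !mxE -!mulr2n eqr_pMn2r// => /eqP.
Qed.

(* Uniqueness forces the minimiser to be fixed by every affine symmetry
   [x |-> m + A (x - m)] of [P], which acts on the family by
   [(nu, S) |-> (m + A (nu - m), A S A^T)]. *)
Lemma unique_minimiser_parameters (f : R -> R) m M P Q nu S (i0 : 'I_d) :
  @convex_function R R^o `]0, +oo[%classic f -> posdefmx M ->
  elliptically_symmetric P m M -> Od_invariant Q ->
  is_unique_minimiser [set th : 'cV[R]_d * 'M[R]_d | posdefmx th.2]
    (fun th => fdiv f P (loc_scale Q th.1 th.2)) (nu, S) ->
  nu = m /\ exists2 l, 0 < l & S = l *: M.
Proof.
move=> f_convex M_pd Psym Qinv [[/= S_pd nuS_min] nuS_uniq].
have [B_pd _] := sqrtmxP M_pd; have Bu := posdefmx_unit B_pd.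
have fixed O : orthogonalmx O ->
    let A := sqrtmx M *m O *m invmx (sqrtmx M) in
    m - A *m m + A *m nu = nu /\ A *m S *m A^T = S.
  move=> oO A; have Au : A \in unitmx.
    by rewrite !unitmx_mul Bu unitmx_inv Bu (mulmx1_unit oO).2.
  suff /nuS_uniq[-> ->] : is_minimiser [set th : 'cV[R]_d * 'M[R]_d | posdefmx th.2]
    (fun th => fdiv f P (loc_scale Q th.1 th.2))
    (m - A *m m + A *m nu, A *m S *m A^T) by [].
  split=> /=; first exact: posdefmx_congr.
  (* The same affine map fixes [P] and carries the member at [(nu, S)] to the one at the new
     parameters, so both have the same divergence. *)
  move=> th /nuS_min; rewrite (fdiv_affine f_convex Au (elliptic_invariant M_pd oO Psym)
    (loc_scale_affine _ _ Qinv Au S_pd)).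
  exact.
split; first exact: (reflection_fixpoint Bu (fixed _ orthogonalmxN1).1).
have [l Sl] := congr_invariant_scale i0 M_pd (fun O oO => (fixed O oO).2).
(* [l] is positive because [S] and [M] both have a positive entry at [(i0, i0)]. *)
exists l => //; have := posdefmx_diag_gt0 i0 S_pd.
by rewrite Sl mxE pmulr_lgt0// posdefmx_diag_gt0.
Qed.

Lemma elliptic_mean P m M : posdefmx M -> elliptically_symmetric P m M ->
  finite_moment 1 P -> mean P = m.
Proof.
move=> M_pd Psym P1; have [/posdefmx_unit Bu _] := sqrtmxP M_pd.
apply: (reflection_fixpoint Bu); apply/esym.
exact: mean_affine (elliptic_invariant M_pd orthogonalmxN1 Psym) P1.
Qed.

Lemma elliptic_covmx P m M (i0 : 'I_d) : posdefmx M ->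
  elliptically_symmetric P m M -> finite_moment 2 P -> ~ is_dirac P ->
  exists2 l, 0 < l & covmx P = l *: M.
Proof.
move=> M_pd Psym P2 Pnd.
have [|l El] := @congr_invariant_scale R d M (covmx P) i0 M_pd.
  by move=> O oO /=; rewrite -(covmx_affine (elliptic_invariant M_pd oO Psym) P2).
(* A variance is nonnegative, so [l >= 0]; [l = 0] would make [P] a Dirac measure. *)
exists l => //; rewrite lt_neqAle; apply/andP; split.
  by apply/eqP => l0; apply: Pnd; apply: covmx_eq0_dirac => //; rewrite El -l0 scale0r.
have := covmx_diag_ge0 P i0.
by rewrite El mxE pmulr_lge0// posdefmx_diag_gt0.
Qed.

(** Makes [elliptic_mean] and [elliptic_covmx] apply to the base distribution, giving mean 0 and a
    scalar covariance. *)
Lemma Od_invariant_elliptic Q : Od_invariant Q -> elliptically_symmetric Q 0 1%:M.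
Proof.
move=> Qinv; exists Q => // B mB; rewrite /pushforward; congr (Q _).
by apply/seteqP; split=> x; rewrite /= /loc_scale_map sqrtmx1 mul1mx add0r.
Qed.

Lemma mean_loc_scale Q nu S : Od_invariant Q -> finite_moment 1 Q ->
  mean (loc_scale Q nu S) = nu.
Proof.
move=> Qinv Q1; rewrite (@mean_affine _ _ Q _ nu (sqrtmx S))//.
by rewrite (elliptic_mean posdefmx1 (Od_invariant_elliptic Qinv))// mulmx0 addr0.
Qed.

Lemma covmx_loc_scale Q nu S (i0 : 'I_d) : Od_invariant Q -> posdefmx S ->
  finite_moment 2 Q -> ~ is_dirac Q ->
  exists2 l, 0 < l & covmx (loc_scale Q nu S) = l *: S.
Proof.
move=> Qinv S_pd Q2 Qnd; have [B_pd BS] := sqrtmxP S_pd.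
have [l l0 El] := elliptic_covmx i0 posdefmx1 (Od_invariant_elliptic Qinv) Q2 Qnd.
exists l => //; rewrite (@covmx_affine _ _ Q _ nu (sqrtmx S))// El B_pd.1.
by rewrite -scalemxAr -scalemxAl mulmx1 BS.
Qed.

End symmetry.

Theorem corollary4p5 (R : realType) (d : nat) (hd : (0 < d)%N)
    (f : R -> R)
    (f_convex : @convex_function R R^o `]0, +oo[%classic f) (f1 : f 1 = 0)
    (m : 'cV[R]_d) (M : 'M[R]_d) (hM : posdefmx M)
    (P Q0 : probability (borelRd R d) R)
    (hP : elliptically_symmetric P m M) (hQ0 : Od_invariant Q0)
    (nu : 'cV[R]_d) (S : 'M[R]_d)
    (hmin : is_unique_minimiser
       [set th : 'cV[R]_d * 'M[R]_d | posdefmx th.2]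
       (fun th => fdiv f P (loc_scale Q0 th.1 th.2)) (nu, S)) :
  [/\ finite_moment 1 P -> finite_moment 1 Q0 ->
        mean (loc_scale Q0 nu S) = mean P /\ mean P = m,
      finite_moment 2 P -> finite_moment 2 Q0 ->
      ~ is_dirac P -> ~ is_dirac Q0 ->
        (exists2 l : R, 0 < l & covmx (loc_scale Q0 nu S) = l *: M) /\
        (exists2 l : R, 0 < l & covmx P = l *: M)
    & finite_moment 2 P -> finite_moment 2 Q0 ->
      ~ is_dirac P -> ~ is_dirac Q0 ->
      finite_moment2_nondegenerate P -> finite_moment2_nondegenerate Q0 ->
        corrmx (loc_scale Q0 nu S) = corrmx P /\
        corrmx P = normalise_diag M].
Proof.
pose i0 := Ordinal hd.
have S_pd : posdefmx S by case: hmin => -[].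
have [nuE [s s0 SE]] := unique_minimiser_parameters i0 f_convex hM hP hQ0 hmin.
have cov_shape : finite_moment 2 P -> finite_moment 2 Q0 ->
    ~ is_dirac P -> ~ is_dirac Q0 ->
    (exists2 l : R, 0 < l & covmx (loc_scale Q0 nu S) = l *: M) /\
    (exists2 l : R, 0 < l & covmx P = l *: M).
  move=> P2 Q2 Pnd Qnd; split; last exact: elliptic_covmx hP P2 Pnd.
  have [l l0 ->] := covmx_loc_scale nu i0 hQ0 S_pd Q2 Qnd.
  by exists (l * s); rewrite ?mulr_gt0// SE scalerA.
split=> [P1 Q1|//|P2 Q2 Pnd Qnd _ _].
  by rewrite mean_loc_scale// (elliptic_mean hM hP P1).
(* Both covariances lie on the ray of [M], and normalisation removes the factors [l] and [k]. *)
have [[l l0 QE] [k k0 PE]] := cov_shape P2 Q2 Pnd Qnd.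
by rewrite /corrmx QE PE !normalise_diag_scale.
Qed.
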